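(* Let $\{G_i\}_{i\ge1}$ be connected non-bipartite finite graphs on $N_i$ vertices with $N_i\to\infty$, all vertex degrees in $[3,d]$, spectral gaps $\sigma(G_i)\ge\sigma>0$, and girths at least $c\log N_i$ for a fixed $c>0$. Let $G=\bigsqcup_i G_i$, let $j$ be even, and let $\Gamma_\alpha$ be constructed from a random labeling $\alpha$ of $G$ by words in $S^j$. Let $p\ge2$. Then almost surely the following holds: there are constants $a,b,K>0$ (independent of $Y$, the action, $i$ and $f$) such that for every metric space $Y$ and every action of $\Gamma_\alpha$ on $Y$ by isometries, there exist arbitrarily large $N_i$ such that for every $f\in B(X,Y)$ there is an integer $m$ with $a\log N_i\le m\le b\log N_i$ and $$\mathcal E^{(p)}_{\mu_X^{jm}}(f)\le K\big(\Lambda^{(p)}_Y(\sigma,N_i)\big)^p\,\mathcal E^{(p)}_{\mu_X^j}(f).$$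
   Context: $\Gamma$ is the free group on a symmetric set $S$ of size $2k$, $X=\mathrm{Cay}(\Gamma,S)$, $\mu_X(x\to xs)=\frac1{2k}$ the standard random walk, $\mu_X^n$ its convolution powers. Random labeling: for each edge of $G$ independently, one orientation gets a uniform element of $S^j$ (word of length $j$), the reverse orientation its inverse. $\Gamma_\alpha$ is the quotient of $\Gamma$ by the normal closure of all products of labels read along cycles of $G$. $\Gamma$ acts on $Y$ through $\Gamma\to\Gamma_\alpha$; $B(X,Y)$ is the set of $\Gamma$-equivariant maps $f:X\to Y$ (these are the pull-backs of equivariant maps on the Cayley graph of $\Gamma_\alpha$). For an equivariant random walk $\eta$ on $X$: $\mathcal E^{(p)}_\eta(f)=\frac12\sum_{x'}\eta(x_0\to x')d_Y(f(x_0),f(x'))^p$ (independent of $x_0$). Spectral gap of a graph: $1$ minus the second largest eigenvalue of the averaging operator of the standard random walk. Poincaré modulus: for a metric space $Z$, $\Lambda^{(p)}_Z(\sigma)$ is the least $\Lambda$ such that for every finite reversible ergodic Markov chain $(V,\mu,\nu)$ (state space $V$, transition probabilities $\mu$, reversible probability measure $\nu$) with spectral gap $\ge\sigma$ and every $f:V\to Z$, $\sum_{u,v}\nu(u)\nu(v)d_Z(f(u),f(v))^p\le\Lambda^p\sum_{u,v}\nu(u)\mu(u\to v)d_Z(f(u),f(v))^p$. Local modulus: $\Lambda^{(p)}_Y(\sigma,N)=\sup\{\Lambda^{(p)}_{Y'}(\sigma):Y'\subseteq Y,\ |Y'|\le N\}$. *)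

(* Defs.v *)
From HB Require Import structures.
From mathcomp Require Import all_boot all_order all_algebra.
From mathcomp Require Import all_classical all_reals all_analysis.
From Stdlib Require List.
Set Implicit Arguments. Unset Strict Implicit. Unset Printing Implicit Defensive.
Import Order.TTheory GRing.Theory Num.Theory.
Local Open Scope ring_scope.

(* A letter (generator index, sign); S has 2k elements. *)
Definition letter (k : nat) := ('I_k * bool)%type.
Definition inv_letter k (x : letter k) : letter k := (x.1, ~~ x.2).
Definition inv_word k (w : seq (letter k)) : seq (letter k) :=
  rev (map (@inv_letter k) w).

Fixpoint reduced k (w : seq (letter k)) : bool :=
  match w with
  | x :: ((y :: _) as t) => (y != inv_letter x) && reduced t
  | _ => true
  end.

Definition push k (x : letter k) (s : seq (letter k)) : seq (letter k) :=
  match s with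
  | y :: t => if y == inv_letter x then t else x :: s
  | [::] => [:: x]
  end.
Definition reduce k (w : seq (letter k)) : seq (letter k) :=
  foldr (@push k) [::] w.

Lemma reduced_tail k (x : letter k) t : reduced (x :: t) -> reduced t.
Proof. by case: t => //= y t /andP[]. Qed.

Lemma reduce_reduced k (w : seq (letter k)) : reduced (reduce w).
Proof.
elim: w => //= x w IH; rewrite /push.
case E: (reduce w) IH => [|y t] //= Hr.
case: eqP => [_|/eqP ne]; first exact: reduced_tail Hr.
by rewrite /= ne Hr.
Qed.

Definition FreeGroup (k : nat) := {w : seq (letter k) | reduced w}.
Definition fg_elt k (w : seq (letter k)) : FreeGroup k :=
  exist _ (reduce w) (reduce_reduced w).
Definition fg_one k : FreeGroup k := fg_elt [::].
Definition fg_mul k (g h : FreeGroup k) : FreeGroup k :=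
  fg_elt (proj1_sig g ++ proj1_sig h).

Definition is_metric (R : realType) (Y : Type) (dY : Y -> Y -> R) : Prop :=
  [/\ forall x y, dY x y = 0 <-> x = y,
      forall x y, dY x y = dY y x &
      forall x y z, dY x z <= dY x y + dY y z].

Definition isometric_action (R : realType) k (Y : Type) (dY : Y -> Y -> R)
  (act : FreeGroup k -> Y -> Y) : Prop :=
  [/\ forall y, act (fg_one k) y = y,
      forall g h y, act (fg_mul g h) y = act g (act h y) &
      forall g x y, dY (act g x) (act g y) = dY x y].

(* B(X,Y): Gamma-equivariant maps from X = Cay(Gamma,S) (vertex set Gamma) to Y *)
Definition equivariant k (Y : Type) (act : FreeGroup k -> Y -> Y)
  (f : FreeGroup k -> Y) : Prop :=
  forall g x, f (fg_mul g x) = act g (f x).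

(* E^{(p)}_{mu_X^n}(f), computed at x0 = 1:
   mu_X^n(1 -> x') is the probability that a uniform word of length n in S
   represents x', so sum_{x'} mu_X^n(1 -> x') d(f 1, f x')^p is the average
   over the (2k)^n words w of length n of d(f 1, f w)^p. *)
Definition energy (R : realType) k (Y : Type) (dY : Y -> Y -> R) (p : R)
  (n : nat) (f : FreeGroup k -> Y) : R :=
  2^-1 * \sum_(w : n.-tuple (letter k))
     ((2 * k)%:R ^- n * (dY (f (fg_one k)) (f (fg_elt (tval w)))) `^ p).

(* "spectral gap of A is >= sigma", i.e. the second largest eigenvalue of A
   (eigenvalues counted with algebraic multiplicity) is <= 1 - sigma:
   at most one eigenvalue, counted with multiplicity, exceeds 1 - sigma. *)
Definition spectral_gap_ge (R : realType) n (A : 'M[R]_n) (sigma : R) : Prop :=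
  forall s : seq R, uniq s -> (forall x, x \in s -> 1 - sigma < x) ->
    (\sum_(x <- s) mup x (char_poly A) <= 1)%N.

Definition deg n (adj : rel 'I_n) (u : 'I_n) : nat := #|[set v | adj u v]|.

Definition avg_op (R : realType) n (adj : rel 'I_n) : 'M[R]_n :=
  \matrix_(u, v) ((adj u v)%:R / (deg adj u)%:R).

Definition simple_graph n (adj : rel 'I_n) : Prop :=
  (forall u v, adj u v = adj v u) /\ (forall u, ~~ adj u u).
Definition connected_graph n (adj : rel 'I_n) : Prop :=
  forall u v, connect adj u v.
Definition bipartite n (adj : rel 'I_n) : Prop :=
  exists c : 'I_n -> bool, forall u v, adj u v -> c u != c v.

Definition simple_cycle n (adj : rel 'I_n) (s : seq 'I_n) : bool :=
  [&& 3 <= size s, uniq s & cycle adj s]%N.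

Definition girth_ge (R : realType) n (adj : rel 'I_n) (g : R) : Prop :=
  forall s, simple_cycle adj s -> g <= (size s)%:R.

Definition edge_of n (adj : rel 'I_n) :=
  {e : 'I_n * 'I_n | (e.1 < e.2)%N && adj e.1 e.2}.

(* a labeling of G_i: the orientation u -> v (u < v) of each edge gets
   a word of length j in S; the reverse orientation gets its inverse *)
Definition labeling_i k j n (adj : rel 'I_n) :=
  {ffun edge_of adj -> j.-tuple (letter k)}.

Definition label k j n (adj : rel 'I_n) (a : labeling_i k j adj)
  (u v : 'I_n) : seq (letter k) :=
  match @insub _ (fun e : 'I_n * 'I_n => (e.1 < e.2)%N && adj e.1 e.2)
               (edge_of adj) (u, v) with
  | Some e => tval (a e)
  | None =>
    match @insub _ (fun e : 'I_n * 'I_n => (e.1 < e.2)%N && adj e.1 e.2)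
                 (edge_of adj) (v, u) with
    | Some e => inv_word (tval (a e))
    | None => [::]
    end
  end.

Definition cycle_word k j n (adj : rel 'I_n) (a : labeling_i k j adj)
  (s : seq 'I_n) : seq (letter k) :=
  flatten [seq label a e.1 e.2 | e <- zip s (rot 1 s)].

(* Gamma acts through Gamma_alpha: all relators act trivially.  Since the
   kernel of an action is normal, this is the same as the normal closure of
   the relators acting trivially. *)
Definition kills_relators k j (N : nat -> nat) (adj : forall i, rel 'I_(N i))
  (alpha : forall i, labeling_i k j (adj i)) (Y : Type)
  (act : FreeGroup k -> Y -> Y) : Prop :=
  forall i s, simple_cycle (adj i) s ->
    forall y, act (fg_elt (cycle_word (alpha i) s)) y = y.

(* Omega = prod_i L_i with L_i finite, equipped with the product of the
   uniform probabilities.  A rectangle fixes finitely many coordinates: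
   {w | forall i < M, w i \in A i}, of probability prod_{i<M} |A i|/|L i|.
   A set is null iff it has outer measure 0 (Caratheodory extension from the
   semiring of rectangles); "almost surely P" means {w | ~ P w} is null. *)
Definition rect_prob (R : realType) (L : nat -> finType) (M : nat)
  (A : forall i, {set L i}) : R :=
  \prod_(i < M) (#|A i|%:R / #|L i|%:R).

Definition in_rect (L : nat -> finType) (M : nat) (A : forall i, {set L i})
  (w : forall i, L i) : Prop := forall i, (i < M)%N -> w i \in A i.

Definition prod_null (R : realType) (L : nat -> finType)
  (B : (forall i, L i) -> Prop) : Prop :=
  forall eps : R, 0 < eps ->
    exists (M : nat -> nat) (A : nat -> forall i, {set L i}),
      (forall w, B w -> exists n, in_rect (M n) (A n) w) /\
      (forall n0, \sum_(n < n0) rect_prob R (M n) (A n) <= eps).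

Definition almost_surely (R : realType) (L : nat -> finType)
  (P : (forall i, L i) -> Prop) : Prop :=
  prod_null R (fun w => ~ P w).

(* finite reversible ergodic (= irreducible) Markov chain on 'I_n *)
Definition rev_markov_chain (R : realType) n (mu : 'M[R]_n) (nu : 'I_n -> R)
  : Prop :=
  [/\ (forall u v, 0 <= mu u v) /\ (forall u, \sum_v mu u v = 1),
      (forall u, 0 <= nu u) /\ \sum_u nu u = 1,
      forall u v, nu u * mu u v = nu v * mu v u &
      forall u v, connect (fun a b => 0 < mu a b) u v].

(* Lambda is an admissible constant in the definition of Lambda^{(p)}_{Z}(sigma)
   for the subspace Z of Y consisting of the points listed in Z *)
Definition poincare_ok (R : realType) (Y : Type) (dY : Y -> Y -> R) (p : R)
  (sigma : R) (Z : seq Y) (Lam : R) : Prop :=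
  forall n (mu : 'M[R]_n) (nu : 'I_n -> R),
    rev_markov_chain mu nu -> spectral_gap_ge mu sigma ->
    forall f : 'I_n -> Y, (forall u, List.In (f u) Z) ->
      \sum_u \sum_v nu u * nu v * (dY (f u) (f v)) `^ p
      <= Lam `^ p * \sum_u \sum_v nu u * mu u v * (dY (f u) (f v)) `^ p.

(* Lambda^{(p)}_Z(sigma) = least admissible Lambda >= 0 (+oo if none) *)
Definition poincare_modulus (R : realType) (Y : Type) (dY : Y -> Y -> R)
  (p sigma : R) (Z : seq Y) : \bar R :=
  ereal_inf [set Lam%:E | Lam in [set Lam : R | 0 <= Lam /\
                                   poincare_ok dY p sigma Z Lam]].

Definition local_modulus (R : realType) (Y : Type) (dY : Y -> Y -> R)
  (p sigma : R) (N : nat) : \bar R :=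
  ereal_sup [set poincare_modulus dY p sigma Z |
             Z in [set Z : seq Y | (size Z <= N)%N]].

(* Main.v *)
Require Import Defs.
From HB Require Import structures.
From mathcomp Require Import all_boot all_order all_algebra.
From mathcomp Require Import all_classical all_reals all_analysis.
From mathcomp Require Import zify ring lra.
Set Implicit Arguments. Unset Strict Implicit. Unset Printing Implicit Defensive.
Import Order.TTheory GRing.Theory Num.Theory.
Local Open Scope ring_scope.

(** At every vertex fix a cyclic order of the neighbours.  Leaving a vertex by
the neighbour that follows the one it was entered from is a permutation of the
oriented edges of [G_i], and iterating it [m] times from every oriented edge
gives a family of non-backtracking walks of length [m] whose two endpoints are
both distributed according to the stationary measure.  For [m] of order
[log N_i] below the girth these walks are simple paths, so each of them reads a
uniform word of [S^(jm)], and every walk shares an edge with at most [2 m^2]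
others.  By Chebyshev's inequality and a union bound, with probability at least
1/2 every word of [S^(jm)] is read with the right frequency up to a factor
[3/2] or [1/2], and likewise for single edges.  The labelings being
independent, almost surely this happens for infinitely many [i].

For such an [i], an equivariant [f] descends to a map [h] from [G_i] to [Y],
because closed walks act trivially.  The energy of [f] for [mu_X^(jm)] is then
comparable to the average of [d(h u, h v)^p] over the endpoints of the walks,
which the triangle inequality bounds by the average over independent stationary
[u] and [v]; the Poincare inequality bounds the latter by the energy of [h],
which is comparable to the energy of [f] for [mu_X^j]. *)

(** * Free group and closed walks *)

Section FreeGroupTheory.
Variable k : nat.
Implicit Types (x : letter k) (s u v w : seq (letter k)).

Lemma inv_letterK : involutive (@inv_letter k).
Proof. by case=> i b; rewrite /inv_letter /= negbK. Qed.

Lemma inv_wordK : involutive (@inv_word k).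
Proof.
by move=> w; rewrite /inv_word map_rev revK -map_comp map_id_in // => x _; exact: inv_letterK.
Qed.

Lemma size_inv_word w : size (inv_word w) = size w.
Proof. by rewrite size_rev size_map. Qed.

Lemma pushK x s : reduced s -> push x (push (inv_letter x) s) = s.
Proof.
case: s => [|y t] /= rs; first by rewrite eqxx.
rewrite inv_letterK; case: (eqVneq y x) => [eyx|nyx] /=; last by rewrite eqxx.
subst y; case: t rs => [|z t] //= /andP[/negbTE -> _] //.
Qed.

Lemma reduced_push x s : reduced s -> reduced (push x s).
Proof.
case: s => [|y t] //= rs; case: eqP => [_|/eqP nyx]; first exact: reduced_tail rs.
by rewrite /= nyx.
Qed.

Lemma reduced_foldr s w : reduced s -> reduced (foldr (@push k) s w).
Proof. by move=> rs; elim: w => //= x w; exact: reduced_push. Qed.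

(** [push x] and [push (inv_letter x)] cancel on reduced words by [pushK], so a cancellation made
    inside [w] beforehand does not change the result. This is what makes [fg_elt] multiplicative. *)
Lemma foldr_push_reduce s w : reduced s ->
  foldr (@push k) s (reduce w) = foldr (@push k) s w.
Proof.
move=> rs; elim: w => //= x w <-; rewrite /push.
case: (reduce w) => [|y t] //=; case: (eqVneq y (inv_letter x)) => [->|//].
by rewrite -/(push x _) pushK //; exact: reduced_foldr.
Qed.

Lemma reduce_id w : reduced w -> reduce w = w.
Proof.
elim: w => // x w IH rw /=; rewrite IH ?(reduced_tail rw) //.
by case: w rw {IH} => [|y t] //= /andP[/negbTE -> _].
Qed.

Lemma reduce_cat u v : reduce (u ++ v) = foldr (@push k) (reduce v) u.
Proof. by rewrite /reduce foldr_cat. Qed.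

Lemma fg_elt_eq u v : reduce u = reduce v -> fg_elt u = fg_elt v.
Proof. by move=> e; apply/val_inj. Qed.

Lemma fg_mul_elt u v : fg_mul (fg_elt u) (fg_elt v) = fg_elt (u ++ v).
Proof.
apply: fg_elt_eq => /=; rewrite !reduce_cat foldr_push_reduce ?reduce_reduced //.
by rewrite (reduce_id (reduce_reduced v)).
Qed.

Lemma fg_mul_elt1 w : fg_mul (fg_elt w) (fg_one k) = fg_elt w.
Proof. by rewrite fg_mul_elt cats0. Qed.

Lemma inv_word_cons x w : inv_word (x :: w) = rcons (inv_word w) (inv_letter x).
Proof. by rewrite /inv_word /= rev_cons. Qed.

Lemma fg_elt_invl w : fg_elt (inv_word w ++ w) = fg_one k.
Proof.
apply: fg_elt_eq; elim: w => //= x w IH.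
rewrite inv_word_cons cat_rcons reduce_cat /=.
have /= := pushK (inv_letter x) (reduce_reduced w); rewrite inv_letterK => ->.
by rewrite -reduce_cat.
Qed.

End FreeGroupTheory.

Section WalkAction.
Variables (R : realType) (k : nat) (Y : Type) (dY : Y -> Y -> R).
Variable act : FreeGroup k -> Y -> Y.
Hypothesis actP : isometric_action dY act.

Lemma act_cat u v y :
  act (fg_elt (u ++ v)) y = act (fg_elt u) (act (fg_elt v) y).
Proof. by case: actP => _ actM _; rewrite -fg_mul_elt actM. Qed.

Lemma act_nil y : act (fg_elt [::]) y = y.
Proof. by case: actP. Qed.

Lemma act_invl w y : act (fg_elt (inv_word w)) (act (fg_elt w) y) = y.
Proof. by rewrite -act_cat fg_elt_invl; case: actP. Qed.

Lemma act_invr w y : act (fg_elt w) (act (fg_elt (inv_word w)) y) = y.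
Proof. by rewrite -{1}(inv_wordK w) act_invl. Qed.

Section Walks.
Variables (V : eqType) (e : rel V) (lab : V -> V -> seq (letter k)).

Fixpoint walk_word (x : V) (q : seq V) : seq (letter k) :=
  if q is y :: q' then lab x y ++ walk_word y q' else [::].

Lemma walk_word_cat x q1 q2 :
  walk_word x (q1 ++ q2) = walk_word x q1 ++ walk_word (last x q1) q2.
Proof. by elim: q1 x => //= y q1 IH x; rewrite IH catA. Qed.

Lemma walk_word_rcons x q z :
  walk_word x (rcons q z) =
  flatten [seq lab a.1 a.2 | a <- zip (x :: q) (rcons q z)].
Proof. by elim: q x => [|y q IH] x //=; rewrite IH. Qed.

Lemma not_uniq_split (T : eqType) (s : seq T) : ~~ uniq s ->
  exists x q1 q2 q3, s = q1 ++ x :: q2 ++ x :: q3.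
Proof.
elim: s => //= y s IH; rewrite negb_and negbK; case/orP=> [ys|/IH].
  by case/splitPr: ys => q1 q2; exists y, [::], q1, q2.
by case=> x [q1 [q2 [q3 ->]]]; exists x, (y :: q1), q2, q3.
Qed.

Hypotheses (e_irr : irreflexive e)
  (lab_inv : forall x y, e x y -> lab y x = inv_word (lab x y))
  (cycle_triv : forall s, (3 <= size s)%N -> uniq s -> cycle e s -> forall y,
     act (fg_elt (flatten [seq lab a.1 a.2 | a <- zip s (rot 1 s)])) y = y).

(** Strong induction on the length. If a vertex [z] is entered twice, the loop at [z] and the walk
    without this loop are both shorter closed walks. Otherwise the walk is empty, or goes back and
    forth along one edge, where the two labels cancel, or is a simple cycle. *)
Lemma closed_walk_act x q y : path e x q -> last x q = x ->
  act (fg_elt (walk_word x q)) y = y.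
Proof.
have [n] := ubnP (size q); elim: n => // n IH in x q y *.
rewrite ltnS => szq pq lq.
case: (boolP (uniq q)) => [uq|/not_uniq_split].
  case/lastP: q => [|q z] in szq pq lq uq *; first by rewrite /= act_nil.
  rewrite last_rcons in lq; subst z; rewrite rcons_uniq in uq.
  case: q => [|z [|z' q]] in szq pq uq *.
  - by rewrite /= e_irr in pq.
  - move: pq => /= /and3P[xz _ _]; rewrite (lab_inv xz) cats0.
    by rewrite act_cat act_invr.
  rewrite walk_word_rcons -rot1_cons; exact: cycle_triv.
case=> z [q1 [q2 [q3 eq]]]; subst q.
have wE : walk_word x (q1 ++ z :: q2 ++ z :: q3) =
    walk_word x (rcons q1 z) ++ walk_word z (rcons q2 z) ++ walk_word z q3.
  rewrite -cat_rcons walk_word_cat last_rcons -cat_rcons walk_word_cat.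
  by rewrite last_rcons.
have [pq1 [pq2 pq3]] : path e x (rcons q1 z) /\ path e z (rcons q2 z) /\ path e z q3.
  move: pq; rewrite -cat_rcons cat_path last_rcons -cat_rcons cat_path last_rcons.
  by case/and3P.
have mid y' : act (fg_elt (walk_word z (rcons q2 z))) y' = y'.
  apply: IH; rewrite ?last_rcons //.
  by move: szq; rewrite size_rcons !size_cat /= size_cat /=; lia.
rewrite wE !act_cat mid.
have := walk_word_cat x (rcons q1 z) q3; rewrite last_rcons -act_cat => <-.
apply: IH.
- by move: szq; rewrite !size_cat /= size_cat /= size_rcons; lia.
- by rewrite cat_path last_rcons pq1.
- by move: lq; rewrite !last_cat /= last_cat last_rcons.
Qed.

(** Closing either walk by [q3], the reverse of [q2], gives a closed walk, so both words act as the
    inverse of the word of [q3]. *)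
Lemma walk_act_eq x q1 q2 y : symmetric e -> path e x q1 -> path e x q2 ->
  last x q1 = last x q2 ->
  act (fg_elt (walk_word x q1)) y = act (fg_elt (walk_word x q2)) y.
Proof.
move=> es p1 p2 l12.
pose q3 := rev (belast x q2).
have p3 : path e (last x q2) q3.
  by rewrite /q3 rev_path; apply: sub_path p2 => u v; rewrite es.
have l3 : last (last x q2) q3 = x.
  by rewrite /q3; case: (q2) => //= z q; rewrite rev_cons last_rcons.
have w3 y' : act (fg_elt (walk_word x q2)) (act (fg_elt (walk_word (last x q2) q3)) y') = y'.
  by rewrite -act_cat -walk_word_cat closed_walk_act ?cat_path ?p2 ?last_cat.
rewrite -[in LHS](closed_walk_act (x := last x q2) (q := q3 ++ q2) y).
- rewrite walk_word_cat l3 act_cat.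
  set z := act (fg_elt (walk_word x q2)) y.
  rewrite -act_cat -l12 -walk_word_cat closed_walk_act ?cat_path ?p1 ?l12 //.
  by rewrite last_cat l12.
- by rewrite cat_path p3 l3.
- by rewrite last_cat l3.
Qed.

End Walks.
End WalkAction.

(** * Equidistribution of the labels of a family of walks *)

(** One value is allowed at each of the [#|I|] points in the image of [x], and all of [T] elsewhere.
    The product form avoids division and a difference of exponents. *)
Lemma card_prescribed (E T I : finType) (x : I -> E) (w : I -> T) :
  injective x ->
  (#|[set a : {ffun E -> T} | [forall i, a (x i) == w i]]| * #|T| ^ #|I| =
   #|{ffun E -> T}|)%N.
Proof.
move=> xI.
pose F y : pred T := [pred t | [forall i, (x i == y) ==> (t == w i)]].
have -> : #|[set a : {ffun E -> T} | [forall i, a (x i) == w i]]| = #|family F|.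
  apply: eq_card => a; rewrite inE; apply/forallP/familyP => [h y|h i].
    by rewrite inE; apply/forallP => i; apply/implyP => /eqP <-; exact: h.
  by have := h (x i); rewrite inE => /forallP/(_ i); rewrite eqxx.
rewrite card_family card_ffun foldrE big_image /= (bigID (mem (codom x))) /=.
rewrite big1 ?mul1n => [|y /codomP[i ->]]; last first.
  rewrite (eq_card (B := pred1 (w i))) ?card1 // => t; rewrite !inE.
  apply/forallP/eqP => [/(_ i)|-> i']; first by rewrite eqxx => /eqP.
  by apply/implyP => /eqP/xI ->.
rewrite (eq_bigr (fun _ => #|T|)) => [|y ny]; last first.
  apply: eq_card => t; rewrite !inE; apply/forallP => i; apply/implyP => /eqP xiy.
  by rewrite -xiy codom_f in ny.
by rewrite prod_nat_const -expnD addnC -(card_codom xI) cardC.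
Qed.

Section WalkLabels.
Variables (R : realType) (E T D : finType).
Variables (tau : D -> D) (und : D -> E) (ori : D -> T -> T) (m : nat).

(** [D] stands for the oriented edges and [tau] for one step of the walk; [und] forgets the
    orientation, and [ori e] turns the label stored on the edge into the one read along [e]. *)
Definition walk_label (a : {ffun E -> T}) (e : D) : m.-tuple T :=
  [tuple ori (iter i tau e) (a (und (iter i tau e))) | i < m].

Definition label_count (w : m.-tuple T) (a : {ffun E -> T}) : nat :=
  #|[set e | walk_label a e == w]|.

(** Denominators are cleared: every word is read between [1/2] and [3/2] times the expected number
    [#|D| / #|T| ^ m]. *)
Definition equidistributed (a : {ffun E -> T}) : bool :=
  [forall w, 2 * `|(#|T| ^ m)%:R * (label_count w a)%:R - #|D|%:R| <= #|D|%:R :> R].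

Hypotheses (tau_inj : injective tau) (oriK : forall e, involutive (ori e)).
Hypothesis und_fiber : forall x, (#|[set e | und e == x]| <= 2)%N.
Hypothesis und_inj : forall e, injective (fun i : 'I_m => und (iter i tau e)).

Local Notation L := #|{ffun E -> T}|.
Local Notation Q := #|T|.

Lemma walk_labelE a e w : (walk_label a e == w) =
  [forall i : 'I_m, a (und (iter i tau e)) == ori (iter i tau e) (tnth w i)].
Proof.
apply/eqP/forallP => [<- i|h]; first by rewrite tnth_mktuple oriK.
by apply: eq_from_tnth => i; rewrite tnth_mktuple (eqP (h i)) oriK.
Qed.

Lemma card_walk_label e w :
  (#|[set a | walk_label a e == w]| * Q ^ m = L)%N.
Proof.
rewrite -(card_prescribed (fun i : 'I_m => ori (iter i tau e) (tnth w i)) (@und_inj e)).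
rewrite card_ord; congr (_ * _)%N; apply: eq_card => a.
by rewrite !inE walk_labelE.
Qed.

Definition edge_disjoint (e e' : D) : bool :=
  [forall i : 'I_m, forall i' : 'I_m, und (iter i tau e) != und (iter i' tau e')].

(** Two edge-disjoint walks together prescribe the labeling on [m + m] distinct edges, so the words
    they read are independent. *)
Lemma card_walk_label2 e e' w : edge_disjoint e e' ->
  (#|[set a | (walk_label a e == w) && (walk_label a e' == w)]| * Q ^ (m + m) = L)%N.
Proof.
move=> dis.
pose x (i : 'I_m + 'I_m) := match i with
  inl i => und (iter i tau e) | inr i => und (iter i tau e') end.
pose v (i : 'I_m + 'I_m) := match i with
  inl i => ori (iter i tau e) (tnth w i) | inr i => ori (iter i tau e') (tnth w i) end.
have xI : injective x.
  have D' i i' : und (iter (i : 'I_m) tau e) <> und (iter (i' : 'I_m) tau e').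
    by apply/eqP; have /forallP/(_ i)/forallP/(_ i') := dis.
  case=> i [i'|i'] /=.
  - by move/(@und_inj e) => ->.
  - by move/D'.
  - by move/esym/D'.
  - by move/(@und_inj e') => ->.
rewrite -(card_prescribed v xI) card_sum card_ord; congr (_ * _)%N.
apply: eq_card => a; rewrite !inE !walk_labelE.
apply/andP/forallP => [[/forallP h1 /forallP h2] [i|i]|h]; [exact: h1|exact: h2|].
by split; apply/forallP => i; [exact: (h (inl i))|exact: (h (inr i))].
Qed.

(** Fix [e] and positions [i], [i']. The edge at position [i] has at most two orientations, and
    [iter i' tau] is injective, so at most two [e'] have that edge at position [i']. *)
Lemma card_dependent :
  (\sum_e \sum_e' ~~ edge_disjoint e e' <= #|D| * (2 * m ^ 2))%N.
Proof.
rewrite -[X in (_ <= X)%N]sum_nat_const; apply: leq_sum => e _.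
have le1 e' : (~~ edge_disjoint e e' <=
    \sum_(i < m) \sum_(i' < m) (und (iter i' tau e') == und (iter i tau e)))%N.
  case: (boolP (edge_disjoint e e')) => // /forallPn[i /forallPn[i']].
  rewrite negbK eq_sym => h; rewrite (bigD1 i) //= (bigD1 i') //= h.
  by rewrite -addnA.
apply: leq_trans (leq_sum _ (fun e' _ => le1 e')) _.
rewrite exchange_big /=; apply: (@leq_trans (\sum_(i < m) \sum_(i' < m) 2)); last first.
  by rewrite !sum_nat_const !card_ord; lia.
apply: leq_sum => i _; rewrite exchange_big /=; apply: leq_sum => i' _.
have itI : injective (iter i' tau) by elim: (nat_of_ord i') => //= n IH u v /tau_inj/IH.
apply: leq_trans (und_fiber (und (iter i tau e))).
rewrite -big_mkcond sum1_card -(card_imset _ itI); apply: subset_leq_card.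
by apply/fintype.subsetP => _ /imsetP[e' he ->]; rewrite inE.
Qed.

(** An unnormalised variance bound. The variables [q * x e - 1] are centred, those of edge-disjoint
    walks are uncorrelated, and each remaining pair contributes at most [q * L]. *)
Lemma second_moment w :
  \sum_a ((Q ^ m)%:R * (label_count w a)%:R - #|D|%:R) ^+ 2 <=
  #|D|%:R * (2 * m ^ 2)%:R * ((Q ^ m)%:R * L%:R) :> R.
Proof.
set q := (Q ^ m)%:R.
pose x e a : R := (walk_label a e == w)%:R.
have devE a : q * (label_count w a)%:R - #|D|%:R = \sum_e (q * x e a - 1).
  rewrite sumrB sumr_const -mulr_sumr /label_count -sum1_card big_mkcond natr_sum.
  congr (_ * _ - _); apply: eq_bigr => e _.
  by rewrite inE /x; case: eqP.
have n1 e : q * (\sum_a x e a) = L%:R.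
  rewrite -(card_walk_label e w) natrM mulrC; congr (_ * _).
  rewrite -sum1_card [in RHS]big_mkcond natr_sum; apply: eq_bigr => a _.
  by rewrite inE /x; case: eqP.
have pairE e e' : \sum_a (q * x e a - 1) * (q * x e' a - 1) =
    q ^+ 2 * (\sum_a x e a * x e' a) - L%:R.
  rewrite mulr_sumr.
  transitivity (\sum_a (q ^+ 2 * (x e a * x e' a) - q * x e a - q * x e' a + 1)).
    by apply: eq_bigr => a _; ring.
  rewrite big_split /= !sumrB -!mulr_sumr !n1 sumr_const -/(L%:R).
  by ring.
have pair_le e e' : \sum_a (q * x e a - 1) * (q * x e' a - 1) <=
    (~~ edge_disjoint e e')%:R * (q * L%:R).
  rewrite pairE; case: (boolP (edge_disjoint e e')) => [dis|_] /=.
    rewrite mul0r -(card_walk_label2 w dis) expnD natrM natrM -/q.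
    have -> : \sum_a x e a * x e' a =
        #|[set a | (walk_label a e == w) && (walk_label a e' == w)]|%:R.
      rewrite -sum1_card [in RHS]big_mkcond natr_sum; apply: eq_bigr => a _.
      by rewrite inE /x -natrM mulnb; case: (_ && _).
    by rewrite mulrC expr2 subrr.
  (* For a dependent pair, drop the negative term and bound the product of the two indicators by one
     of them. *)
  rewrite mul1r; apply: (@le_trans _ _ (q ^+ 2 * \sum_a x e a * x e' a)).
    by rewrite gerBl.
  rewrite expr2 -mulrA; apply: ler_wpM2l; first exact: ler0n.
  rewrite -(n1 e); apply: ler_wpM2l; first exact: ler0n.
  by apply: ler_sum => a _; rewrite /x -natrM mulnb ler_nat; do 2!case: (walk_label _ _ == w).
under eq_bigr do rewrite devE expr2 big_distrlr /=.
rewrite exchange_big /=; under eq_bigr do rewrite exchange_big /=.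
apply: (@le_trans _ _ (\sum_e \sum_e' (~~ edge_disjoint e e')%:R * (q * L%:R))).
  by apply: ler_sum => e _; apply: ler_sum => e' _; exact: pair_le.
under eq_bigr do rewrite -mulr_suml.
rewrite -mulr_suml; apply: ler_wpM2r; first by rewrite mulr_ge0.
under eq_bigr do rewrite -natr_sum.
by rewrite -natr_sum -natrM ler_nat card_dependent.
Qed.

(** Chebyshev's inequality at deviation [#|D| / 2] gives [8 = 4 * 2] and one factor [Q ^ m]; the
    union bound over all words gives the other. *)
Lemma card_not_equidistributed : (0 < #|D|)%N ->
  (#|[set a | ~~ equidistributed a]| * #|D| <= 8 * m ^ 2 * Q ^ (m + m) * L)%N.
Proof.
move=> D0.
pose B w := [set a : {ffun E -> T} |
  #|D|%:R < 2 * `|(#|T| ^ m)%:R * (label_count w a)%:R - #|D|%:R| :> R].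
have Ble w : (#|B w| * #|D| <= 8 * m ^ 2 * Q ^ m * L)%N.
  rewrite -(leq_pmul2r D0) -(ler_nat R).
  apply: (@le_trans _ _ (\sum_a (4 * ((Q ^ m)%:R * (label_count w a)%:R - #|D|%:R) ^+ 2))).
    rewrite -mulnA natrM -sum1_card natr_sum mulr_suml big_mkcond /=.
    apply: ler_sum => a _; case: ifP; last by rewrite mulr_ge0 // sqr_ge0.
    rewrite inE mul1r => h.
    set v := (_ - _) in h *.
    have -> : 4 * v ^+ 2 = (2 * `|v|) ^+ 2.
      by rewrite exprMn real_normK ?num_real // -natrX.
    by rewrite natrM -expr2; apply: lerXn2r; rewrite ?nnegrE ?mulr_ge0 // ltW.
  rewrite -mulr_sumr; apply: le_trans (ler_wpM2l _ (second_moment w)) _ => //.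
  by rewrite -!natrM ler_nat; nia.
apply: (@leq_trans (\sum_w #|B w| * #|D|)); last first.
  apply: leq_trans (leq_sum _ (fun w _ => Ble w)) _.
  by rewrite sum_nat_const card_tuple expnD; nia.
rewrite -big_distrl /= leq_mul2r; apply/orP; right.
rewrite -sum1_card big_mkcond /=.
under [X in (_ <= X)%N]eq_bigr do rewrite -sum1_card big_mkcond.
rewrite exchange_big /=; apply: leq_sum => a _.
rewrite inE; case: ifP => // /forallPn[w]; rewrite -ltNge => h.
by rewrite (bigD1 w) //= inE h.
Qed.

End WalkLabels.

(** * Null sets of a product *)

Lemma prod_null_tail (R : realType) (L : nat -> finType)
    (Bad : forall i, {set L i}) (i1 : nat) :
  (forall i, (i1 <= i)%N -> (2 * #|Bad i| <= #|L i|)%N) ->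
  prod_null R (fun w => exists i0, forall i, (i0 <= i)%N -> w i \in Bad i).
Proof.
move=> half eps eps0.
have [l hl] : exists l : nat, 2 * 2^-1 ^+ l <= eps :> R.
  have [l hl] := ex_intro (fun l => 2 / eps < l%:R) _ (archi_boundP (ltW (divr_gt0 (ltr0n R 2) eps0) )).
  exists l; rewrite exprVn ler_pdivrMr ?exprn_gt0 //.
  rewrite mulrC -ler_pdivrMr //; apply: ltW; apply: lt_le_trans hl _.
  by rewrite -natrX ler_nat ltnW // ltn_expl.
pose st n := maxn n i1.
(* The [n]-th rectangle requires [n + l] consecutive bad coordinates starting at [st n]. It contains
   the tail event from [n] on because [st n >= n], and has probability at most [2 ^ -(n + l)]
   because [st n >= i1]; the sum over [n] is at most [2 * 2 ^ -l]. *)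
exists (fun n => st n + (n + l))%N, (fun n i => if (i < st n)%N then [set: L i] else Bad i).
split.
  move=> w [i0 hw]; exists i0 => i _; case: ltnP => [_|hi]; first by rewrite inE.
  by apply: hw; apply: leq_trans hi; rewrite leq_maxl.
have rp n : rect_prob R (st n + (n + l)) (fun i => if (i < st n)%N then [set: L i] else Bad i)
    <= 2^-1 ^+ n * 2^-1 ^+ l.
  rewrite /rect_prob big_split_ord /= -exprD -[X in _ <= X]mul1r.
  apply: ler_pM.
  - by apply: prodr_ge0 => i _; rewrite divr_ge0.
  - by apply: prodr_ge0 => i _; rewrite divr_ge0.
  (* A free coordinate contributes [1], or [0 / 0 = 0] when [L i] is empty. *)
  - apply: prodr_ile1 => i _; rewrite divr_ge0 //= ltn_ord cardsT.
    by case: (posnP #|L i|) => [->|L0]; rewrite ?invr0 ?mulr0 ?divff ?pnatr_eq0 -?lt0n.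
  rewrite -[X in _ <= _ ^+ X]card_ord -prodr_const; apply: ler_prod => i _.
  rewrite divr_ge0 //= ltnNge leq_addr /=.
  have := half (st n + i)%N (leq_trans (leq_maxr n i1) (leq_addr _ _)).
  case: (posnP #|L (st n + i)%N|) => [-> _|L0 h]; first by rewrite invr0 mulr0 invr_ge0.
  by rewrite ler_pdivrMr ?ltr0n // ler_pdivlMl // -natrM ler_nat.
move=> n0; apply: (@le_trans _ _ (\sum_(n < n0) 2^-1 ^+ n * 2^-1 ^+ l)).
  by apply: ler_sum => i _; exact: rp.
rewrite -mulr_suml; apply: le_trans hl; apply: ler_wpM2r; first by rewrite exprn_ge0.
have -> : \sum_(i < n0) 2^-1 ^+ i = 2 - 2 * 2^-1 ^+ n0 :> R.
  elim: n0 => [|n IH]; first by rewrite big_ord0 expr0 mulr1 subrr.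
  by rewrite big_ord_recr /= IH exprS; field.
by rewrite gerBl mulr_ge0 // exprn_ge0.
Qed.

(** * Non-backtracking walks on a graph *)

Lemma next_neq (T : eqType) (s : seq T) x :
  uniq s -> (1 < size s)%N -> x \in s -> next s x != x.
Proof.
move=> us ss xs; rewrite next_nth xs.
case: s us ss xs => [//|y s] us ss xs.
move: (index_mem x (y :: s)); rewrite xs => lt_i.
rewrite -[X in _ != X](nth_index y xs).
set i := index x (y :: s) in lt_i *.
have [lt_is|ge_is] := ltnP i (size s).
  rewrite -[nth y s i]/(nth y (y :: s) i.+1) nth_uniq //.
  by rewrite -eqSS gtn_eqF.
rewrite nth_default // -[X in X != _]/(nth y (y :: s) 0) nth_uniq //.
by rewrite eq_sym -lt0n (leq_trans _ ge_is).
Qed.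

Section NonBacktracking.
Variables (n : nat) (adj : rel 'I_n) (v : nat -> 'I_n).
Hypotheses (adjI : forall u, ~~ adj u u)
  (v_adj : forall i, adj (v i) (v i.+1)) (v_nb : forall i, v i.+2 != v i).

Lemma iota_path i l : path adj (v i) [seq v t | t <- iota i.+1 l].
Proof. by elim: l i => //= l IH i; rewrite v_adj IH. Qed.

(** Induction on the gap. A repetition strictly inside gives a smaller gap; without one the segment
    closes up to a cycle, whose length is neither 1, as there are no loops, nor 2, as the sequence
    does not backtrack. *)
Lemma repeated_vertex_cycle i l : v i = v (i + l.+1)%N ->
  exists2 s, simple_cycle adj s & (size s <= l.+1)%N.
Proof.
have [b] := ubnP l; elim: b => // b IH in i l *; rewrite ltnS => lb vE.
pose s := [seq v t | t <- iota i l.+1].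
case: (boolP (uniq s)) => [us|/(uniqPn (v i))[x [y [xy]]]].
  exists s; last by rewrite size_map size_iota.
  rewrite /simple_cycle us size_map size_iota /=; apply/andP; split.
    case: l => [|[|l]] // in vE {lb s us} *.
      by rewrite addn1 in vE; have := v_adj i; rewrite -vE (negbTE (adjI _)).
    by have := v_nb i; rewrite vE addn2 eqxx.
  have -> : rcons [seq v t | t <- iota i.+1 l] (v i) = [seq v t | t <- iota i.+1 l.+1].
    by rewrite -[l.+1]addn1 iotaD map_cat /= cats1 vE addnS.
  exact: iota_path.
rewrite size_map size_iota => yl.
have xl := ltn_trans xy yl.
rewrite !(nth_map 0%N) ?size_iota // !nth_iota // => vxy.
have [||s' cs szs] := IH (i + x)%N (y - x).-1; first by lia.
  by rewrite vxy; congr v; lia.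
by exists s' => //; apply: leq_trans szs _; lia.
Qed.

End NonBacktracking.

Section Darts.
Variables (n : nat) (adj : rel 'I_n).
Hypothesis adjP : simple_graph adj.

Definition dart := {e : 'I_n * 'I_n | adj e.1 e.2}.
HB.instance Definition _ := Finite.on dart.

Lemma big_dart (R : nmodType) (F : 'I_n * 'I_n -> R) :
  \sum_(e : dart) F (val e) = \sum_u \sum_(v | adj u v) F (u, v).
Proof.
rewrite pair_big_dep /=.
rewrite (@reindex_omap _ _ _ _ dart val insub) /=; last first.
  by move=> e he; rewrite insubT.
rewrite [LHS]big_mkcond [RHS]big_mkcond; apply: eq_bigr => e _ /=.
by rewrite (valP e) /= (valK e) eqxx -surjective_pairing.
Qed.

Lemma turn_subproof (e : dart) :
  adj (val e).2 (next (enum (adj (val e).2)) (val e).1).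
Proof.
have : next (enum (adj (val e).2)) (val e).1 \in enum (adj (val e).2).
  by rewrite mem_next mem_enum unfold_in adjP.1 (valP e).
by rewrite mem_enum.
Qed.

(** The cyclic order at each vertex is that of [enum]; [next] is undone by [prev], whence
    [turn_inj]. *)
Definition turn (e : dart) : dart := exist _ (_, _) (turn_subproof e).

Lemma turn_inj : injective turn.
Proof.
move=> [[u v] uv] [[u' v'] uv'] /(congr1 val) /= [vE]; subst v'.
move/(can_inj (prev_next (enum_uniq (adj v)))) => uE; subst u'.
exact/val_inj.
Qed.

Definition tail (e : dart) : 'I_n := (val e).1.

Definition reverse (e : dart) : dart :=
  exist _ ((val e).2, (val e).1) (etrans (adjP.1 _ _) (valP e)).

Lemma iter_turn_inj m : injective (iter m turn).
Proof. by elim: m => //= m IH u v /turn_inj/IH. Qed.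

Lemma tail_turn e : tail (turn e) = (val e).2. Proof. by []. Qed.

Section TurnWalk.
Hypothesis deg_gt1 : forall u, (1 < deg adj u)%N.

Lemma tail_turn_neq e : (val (turn e)).2 != tail e.
Proof.
rewrite /turn /tail /=; apply: next_neq; first exact: enum_uniq.
  by rewrite -cardE; have := deg_gt1 (val e).2; rewrite /deg cardsE.
by rewrite mem_enum unfold_in adjP.1 (valP e).
Qed.

(** A repetition would produce a cycle of length at most [m]. The bound [i' <= m] includes the final
    endpoint: all [m + 1] vertices are distinct. *)
Lemma tail_iter_turn_inj (m : nat) e :
  (forall s, simple_cycle adj s -> (m < size s)%N) ->
  forall i i', (i < i')%N -> (i' <= m)%N -> tail (iter i turn e) != tail (iter i' turn e).
Proof.
move=> girth i i' ii' im; apply/eqP => tE.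
have [||||s /girth ms] := @repeated_vertex_cycle n adj (fun t => tail (iter t turn e)) _ _ _ i (i' - i.+1).
- exact: adjP.2.
- by move=> t; rewrite iterS tail_turn; exact: (valP (iter t turn e)).
- by move=> t; rewrite !iterS tail_turn; exact: tail_turn_neq.
- by rewrite tE; congr (tail (iter _ turn e)); lia.
by move=> sl; lia.
Qed.

End TurnWalk.

Definition und_pair (e : 'I_n * 'I_n) := if (e.1 < e.2)%N then e else (e.2, e.1).

Lemma und_subproof (e : dart) :
  ((und_pair (val e)).1 < (und_pair (val e)).2)%N &&
  adj (und_pair (val e)).1 (und_pair (val e)).2.
Proof.
rewrite /und_pair; case: e => [[u v] uv] /=; case: (ltngtP u v) => [lt|lt|/ord_inj uE] /=.
- by rewrite lt.
- by rewrite lt adjP.1.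
- by move: uv; rewrite /= uE (negbTE (adjP.2 _)).
Qed.

Definition und (e : dart) : edge_of adj := exist _ (und_pair (val e)) (und_subproof e).

Lemma und_eq e e' : und e = und e' ->
  val e' = val e \/ val e' = ((val e).2, (val e).1).
Proof.
move/(congr1 val) => /=; rewrite /und_pair; case: (val e) (val e') => [u v] [u' v'] /=.
by case: ifP; case: ifP => _ _ [-> ->]; auto.
Qed.

Lemma und_fiber (x : edge_of adj) : (#|[set e | und e == x]| <= 2)%N.
Proof.
rewrite -(card_imset _ (@val_inj _ _ dart)).
apply: (@leq_trans #|[set val x; ((val x).2, (val x).1)]|); last by rewrite cards2; case: (_ != _).
apply: subset_leq_card; apply/fintype.subsetP => _ /imsetP[e he ->].
move: he; rewrite !inE => /eqP <- /=; rewrite /und_pair; case: (val e) => u v.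
by case: ifP => _ /=; rewrite eqxx ?orbT.
Qed.

(** An edge used twice in the same direction repeats a tail; used in opposite directions, it makes
    the tail at [i] equal to the tail at [i'.+1], which is still at most [m]. *)
Lemma und_iter_turn_inj (m : nat) e : (forall u, (1 < deg adj u)%N) ->
  (forall s, simple_cycle adj s -> (m < size s)%N) ->
  injective (fun i : 'I_m => und (iter i turn e)).
Proof.
move=> deg_gt1 girth.
have key (i i' : 'I_m) : (i < i')%N -> und (iter i turn e) <> und (iter i' turn e).
  move=> ii' /und_eq[] E.
    have := tail_iter_turn_inj deg_gt1 e girth ii' (ltnW (ltn_ord i')).
    by rewrite /tail E eqxx.
  have := tail_iter_turn_inj deg_gt1 e girth (ltnW ii' : (i < i'.+1)%N) (ltn_ord i').
  by rewrite iterS tail_turn E eqxx.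
move=> i i' /= uE; apply/val_inj => /=; case: (ltngtP i i') => // ii'.
  by case: (key _ _ ii').
by case: (key _ _ ii').
Qed.

Section DartLabels.
Variables (k j : nat).

Definition inv_tuple (t : j.-tuple (letter k)) : j.-tuple (letter k) :=
  Tuple (introT eqP (etrans (size_inv_word t) (size_tuple t))).

Lemma inv_tupleK : involutive inv_tuple.
Proof. by move=> t; apply/val_inj; exact: inv_wordK. Qed.

Definition ori (e : dart) : j.-tuple (letter k) -> j.-tuple (letter k) :=
  if ((val e).1 < (val e).2)%N then id else inv_tuple.

Lemma oriK e : involutive (ori e).
Proof. by rewrite /ori; case: ifP => // _; exact: inv_tupleK. Qed.

Lemma label_dart (a : labeling_i k j adj) (e : dart) :
  label a (val e).1 (val e).2 = tval (ori e (a (und e))).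
Proof.
rewrite /label; case: insubP => [x /= /andP[lt_uv _] xE|].
  rewrite /ori lt_uv; congr (tval (a _)); apply/val_inj => /=.
  by rewrite xE /und_pair lt_uv -surjective_pairing.
have := und_subproof e; rewrite /und_pair /= (valP e) andbT => + /negbTE lt_uv.
rewrite lt_uv /= => h.
rewrite insubT /ori lt_uv /=; congr (inv_word (tval (a _))); apply/val_inj => /=.
by rewrite /und_pair lt_uv.
Qed.

Lemma label_sym (a : labeling_i k j adj) u v : adj u v ->
  label a v u = inv_word (label a u v).
Proof.
move=> uv; pose e : dart := exist _ (u, v) uv.
rewrite -[u]/(val e).1 -[v]/(val e).2 label_dart.
rewrite -[label _ _ _]/(label a (val (reverse e)).1 (val (reverse e)).2) label_dart.
have -> : und (reverse e) = und e.
  apply/val_inj => /=; rewrite /und_pair /=; case: ltngtP => // uE.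
  by have := uv; rewrite (ord_inj uE) (negbTE (adjP.2 _)).
rewrite /ori /=; case: ltngtP => //= [_|uE]; first by rewrite inv_wordK.
by have := uv; rewrite (ord_inj uE) (negbTE (adjP.2 _)).
Qed.

End DartLabels.
End Darts.

(** * Transfer of energies *)

Lemma shape_tuples (T : Type) j (s : seq (j.-tuple T)) :
  shape [seq tval t | t <- s] = nseq (size s) j.
Proof. by elim: s => //= t s <-; rewrite size_tuple. Qed.

(** A word of length [j * m] is cut uniquely into [m] blocks of length [j]. This lets words in [S]
    be counted as words in the alphabet of edge labels. *)
Lemma sum_tuple_flatten (R : nmodType) (T : finType) j m (G : seq T -> R) :
  \sum_(w : (j * m).-tuple T) G w =
  \sum_(w : m.-tuple (j.-tuple T)) G (flatten [seq tval t | t <- w]).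
Proof.
have sz (w : m.-tuple (j.-tuple T)) : size (flatten [seq tval t | t <- w]) == (j * m)%N.
  by rewrite size_flatten shape_tuples sumn_nseq size_tuple.
pose h w : (j * m).-tuple T := Tuple (sz w).
have hI : injective h.
  move=> w w' /(congr1 val) /= hE; apply/val_inj.
  apply: (inj_map (@val_inj _ _ (j.-tuple T))).
  by apply: eq_from_flatten_shape hE _; rewrite !shape_tuples !size_tuple.
rewrite (reindex h) //; apply/onW_bij; apply: inj_card_bij hI _.
by rewrite !card_tuple expnM.
Qed.

(** The sum is at most twice the larger term. *)
Lemma powRD_le (R : realType) (x y p : R) : 0 <= x -> 0 <= y -> 0 <= p ->
  (x + y) `^ p <= 2 `^ p * (x `^ p + y `^ p).
Proof.
move=> x0 y0 p0.
wlog xy : x y x0 y0 / x <= y.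
  move=> H; case: (leP x y) => [|/ltW] xy; first exact: H.
  by rewrite addrC [_ `^ p + _]addrC; exact: H.
apply: (@le_trans _ _ ((2 * y) `^ p)).
  by apply: ge0_ler_powR; rewrite ?nnegrE ?addr_ge0 ?mulr_ge0 //; lra.
by rewrite powRM // ler_wpM2l ?powR_ge0 // lerDr powR_ge0.
Qed.

Lemma mem_In (T : eqType) (s : seq T) x : x \in s -> List.In x s.
Proof. by elim: s => //= y s IH; rewrite inE => /orP[/eqP ->|/IH]; auto. Qed.

Section Transfer.
Variables (R : realType) (k j n : nat) (adj : rel 'I_n).
Hypotheses (adjP : simple_graph adj) (adj_conn : connected_graph adj)
  (deg_gt0 : forall u, (0 < deg adj u)%N).
Variables (a : labeling_i k j adj) (Y : Type) (dY : Y -> Y -> R).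
Variables (act : FreeGroup k -> Y -> Y) (f : FreeGroup k -> Y).
Hypotheses (dYP : is_metric dY) (actP : isometric_action dY act)
  (fP : equivariant act f)
  (kill : forall s, simple_cycle adj s ->
     forall y, act (fg_elt (cycle_word a s)) y = y).

Local Notation step := (turn adjP).
Local Notation word_of m e :=
  (walk_label step (und adjP) (@ori n adj k j) m a e).
Local Notation T := #|{: dart adj}|.

Lemma dist_ge0 x y : 0 <= dY x y.
Proof.
case: dYP => d0 dC dT; have := dT x y x; rewrite (dC y x) (d0 x x).2 //; lra.
Qed.

Lemma walk_word_turn m e :
  walk_word (label a) (tail e) [seq tail (iter t step e) | t <- iota 1 m] =
  flatten [seq tval t | t <- word_of m e].
Proof.
have H i l : walk_word (label a) (tail (iter i step e))
    [seq tail (iter t step e) | t <- iota i.+1 l] =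
    flatten [seq label a (tail (iter t step e)) (tail (iter t.+1 step e)) | t <- iota i l].
  by elim: l i => // l IH i; have /= -> := IH i.+1.
rewrite (H 0%N m) -val_enum_ord -!map_comp; congr flatten.
apply: eq_map => i /=; rewrite -label_dart //.
Qed.

(* [h v] is the value of [f] at the label of an arbitrary path from [u0] to [v]. *)
Lemma vertex_map (u0 : 'I_n) : exists h : 'I_n -> Y, forall m (e : dart adj),
  dY (h (tail e)) (h (tail (iter m step e))) =
  dY (f (fg_one k)) (f (fg_elt (flatten [seq tval t | t <- word_of m e]))).
Proof.
have fE w : f (fg_elt w) = act (fg_elt w) (f (fg_one k)).
  by rewrite -fP fg_mul_elt1.
have /choice[q hq] : forall v, exists q, path adj u0 q /\ last u0 q = v.
  by move=> v; case/connectP: (adj_conn u0 v) => q pq lq; exists q.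
exists (fun v => act (fg_elt (walk_word (label a) u0 (q v))) (f (fg_one k))) => m e.
pose vs := [seq tail (iter t step e) | t <- iota 1 m].
have pvs : path adj (tail e) vs.
  apply: (iota_path (v := fun t => tail (iter t step e)) _ 0 m) => t.
  by rewrite iterS tail_turn; exact: (valP (iter t step e)).
have lvs : last (tail e) vs = tail (iter m step e).
  rewrite /vs; case: (m) => // m'.
  by rewrite -{1}[m'.+1]addn1 iotaD map_cat last_cat.
have [pe le] := hq (tail e); have [pm lm] := hq (tail (iter m step e)).
(* The chosen path to [tail e], continued along the walk, ends where the path chosen for the
   endpoint ends, so both act alike. The common prefix then cancels because the action is
   isometric. *)
have <- : act (fg_elt (walk_word (label a) u0 (q (tail e) ++ vs))) (f (fg_one k)) =
    act (fg_elt (walk_word (label a) u0 (q (tail (iter m step e))))) (f (fg_one k)).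
  apply: (walk_act_eq actP (e := adj)) => //.
  - by move=> x; apply: negbTE; exact: adjP.2.
  - by move=> x y xy; exact: label_sym.
  - by move=> s s3 su sc y; apply: kill; rewrite /simple_cycle s3 su.
  - exact: adjP.1.
  - by rewrite cat_path pe le.
  - by rewrite last_cat le lvs lm.
rewrite walk_word_cat le (act_cat actP) fE -walk_word_turn.
by case: actP => _ _ ->.
Qed.

Variable p : R.
Hypothesis p_gt0 : 0 < p.

Section VertexMap.
Variable h : 'I_n -> Y.
Hypothesis hE : forall m (e : dart adj),
  dY (h (tail e)) (h (tail (iter m step e))) =
  dY (f (fg_one k)) (f (fg_elt (flatten [seq tval t | t <- word_of m e]))).
Hypothesis k_gt0 : (0 < k)%N.

Definition walk_energy m : R :=
  \sum_(e : dart adj) dY (h (tail e)) (h (tail (iter m step e))) `^ p.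

Definition pair_energy : R :=
  \sum_(e : dart adj) \sum_(e' : dart adj) dY (h (tail e)) (h (tail e')) `^ p.

(** Group the oriented edges by the word they read. The factor [1/2] in [energy] equals the lower
    bound on relative frequencies, so the constants are [1] on the left and [3] on the right. *)
Lemma walk_energy_bounds m :
  equidistributed R step (und adjP) (@ori n adj k j) m a ->
  T%:R * energy dY p (j * m) f <= walk_energy m <=
  3 * (T%:R * energy dY p (j * m) f).
Proof.
move/forallP => eqd.
pose G (w : m.-tuple (j.-tuple (letter k))) :=
  dY (f (fg_one k)) (f (fg_elt (flatten [seq tval t | t <- w]))) `^ p.
pose Z (w : m.-tuple (j.-tuple (letter k))) := label_count step (und adjP) (@ori n adj k j) w a.
have SE : walk_energy m = \sum_w (Z w)%:R * G w.
  rewrite /walk_energy (partition_big (fun e => word_of m e) xpredT) //=.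
  apply: eq_bigr => w _; rewrite (eq_bigr (fun=> G w)) => [|e /eqP <-]; last by rewrite hE.
  by rewrite sumr_const mulr_natl /Z /label_count cardsE.
have qE : (#|{: j.-tuple (letter k)}| ^ m)%:R = (2 * k)%:R ^+ (j * m) :> R.
  by rewrite card_tuple card_prod card_ord card_bool mulnC -expnM natrX.
pose q : R := (2 * k)%:R ^+ (j * m).
have q0 : 0 < q by rewrite exprn_gt0 // ltr0n muln_gt0.
have EE : T%:R * energy dY p (j * m) f = \sum_w (T%:R / (2 * q)) * G w.
  rewrite /energy (sum_tuple_flatten j m (fun s => (2 * k)%:R ^- (j * m) *
    dY (f (fg_one k)) (f (fg_elt s)) `^ p)) mulrA mulr_sumr.
  apply: eq_bigr => w _; rewrite /G -/q invfM; ring.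
have Zb w : T%:R / (2 * q) <= (Z w)%:R <= 3 * (T%:R / (2 * q)).
  have := eqd w; rewrite qE -/q -/(Z w) => hw.
  have /ler_normlP[h1 h2] : `|q * (Z w)%:R - T%:R| <= T%:R / 2 by lra.
  rewrite mulrA ler_pdivrMr ?mulr_gt0 // ler_pdivlMr ?mulr_gt0 //.
  by apply/andP; split; lra.
rewrite SE EE mulr_sumr; apply/andP; split; apply: ler_sum => w _; rewrite ?mulrA;
  apply: ler_wpM2r; rewrite ?powR_ge0 //; have /andP[] := Zb w; rewrite ?mulrA //.
Qed.

(* The endpoints are compared through the tail of an independent dart; the tail
of [iter m step e] runs over the stationary measure because [step] is bijective. *)
Lemma walk_energy_le m :
  T%:R * walk_energy m <= 2 `^ p * (2 * pair_energy).
Proof.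
case: dYP => _ dC dT.
have -> : 2 * pair_energy = \sum_(e : dart adj) \sum_(e' : dart adj)
   (dY (h (tail e)) (h (tail e')) `^ p +
    dY (h (tail e')) (h (tail (iter m step e))) `^ p).
  under eq_bigr do rewrite big_split.
  rewrite big_split /= mulr2n mulrDl mul1r; congr (_ + _).
  rewrite exchange_big /= /pair_energy; apply: eq_bigr => e _.
  by rewrite (reindex_inj (@iter_turn_inj _ _ adjP m)).
rewrite /walk_energy mulr_sumr mulr_sumr; apply: ler_sum => e _.
rewrite mulr_natl -sumr_const mulr_sumr; apply: ler_sum => e' _.
apply: le_trans (powRD_le (dist_ge0 _ _) (dist_ge0 _ _) (ltW p_gt0)).
by apply: ge0_ler_powR; rewrite ?nnegrE ?addr_ge0 ?dist_ge0 // ltW.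
Qed.

Lemma sum_tail (F : 'I_n -> R) :
  \sum_(e : dart adj) F (tail e) = \sum_u (deg adj u)%:R * F u.
Proof.
rewrite (big_dart adj (fun e => F e.1)); apply: eq_bigr => u _ /=.
by rewrite sumr_const mulr_natl /deg cardsE.
Qed.

Lemma card_dart : T%:R = \sum_u (deg adj u)%:R :> R.
Proof.
by have := sum_tail (fun=> 1); rewrite sumr_const => ->; apply: eq_bigr => u _; rewrite mulr1.
Qed.

Hypothesis T_gt0 : (0 < T)%N.

(** The reversible measure is the law of the tail of a uniform oriented edge. *)
Lemma rev_markov_chain_avg_op :
  rev_markov_chain (avg_op R adj) (fun u => (deg adj u)%:R / T%:R).
Proof.
have d0 u : (deg adj u)%:R != 0 :> R by rewrite pnatr_eq0 -lt0n.
have T0 : T%:R != 0 :> R by rewrite pnatr_eq0 -lt0n.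
split.
- split=> u; first by move=> v; rewrite mxE divr_ge0.
  under eq_bigr do rewrite mxE.
  rewrite -mulr_suml -natr_sum; have -> : (\sum_v adj u v)%N = deg adj u.
    by rewrite /deg -sum1_card [RHS]big_mkcond; apply: eq_bigr => v _; rewrite inE; case: adj.
  by rewrite divff.
- split=> [u|]; first by rewrite divr_ge0.
  by rewrite -mulr_suml -card_dart divff.
- move=> u v; rewrite !mxE (adjP.1 v u).
  by rewrite mulrACA mulrC mulrACA [RHS]mulrACA; field; rewrite !d0 T0.
move=> u v; apply: connect_sub (adj_conn u v) => x y xy.
by apply: connect1; rewrite /= mxE xy mul1r invr_gt0 ltr0n.
Qed.

Lemma pair_energyE : \sum_u \sum_v (deg adj u)%:R / T%:R * ((deg adj v)%:R / T%:R) *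
  dY (h u) (h v) `^ p = pair_energy / T%:R ^+ 2.
Proof.
rewrite /pair_energy (sum_tail (fun u => \sum_e' dY (h u) (h (tail e')) `^ p)).
rewrite mulr_suml; apply: eq_bigr => u _.
rewrite (sum_tail (fun v => dY (h u) (h v) `^ p)) mulr_sumr mulr_suml.
apply: eq_bigr => v _; rewrite expr2 invfM; ring.
Qed.

Lemma step_energyE : \sum_u \sum_v (deg adj u)%:R / T%:R * avg_op R adj u v *
  dY (h u) (h v) `^ p = walk_energy 1 / T%:R.
Proof.
rewrite /walk_energy (big_dart adj (fun e => dY (h e.1) (h e.2) `^ p)) mulr_suml.
apply: eq_bigr => u _; rewrite mulr_suml [RHS]big_mkcond; apply: eq_bigr => v _.
have d0 : (deg adj u)%:R != 0 :> R by rewrite pnatr_eq0 -lt0n.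
have T0 : T%:R != 0 :> R by rewrite pnatr_eq0 -lt0n.
rewrite mxE; case: (adj u v) => /=; last by rewrite mul0r mulr0 mul0r.
by field; rewrite d0 T0.
Qed.

(** With [A] the mean over independent stationary pairs and [C] the mean over edges, the energy at
    [j * m] is at most [2 ^ p * 2 * A], the Poincare inequality gives [A <= Lam ^ p * C], and [C] is
    at most [3] times the energy at [j]. *)
Lemma energy_transfer m sigma :
  spectral_gap_ge (avg_op R adj) sigma ->
  equidistributed R step (und adjP) (@ori n adj k j) m a ->
  equidistributed R step (und adjP) (@ori n adj k j) 1 a ->
  ((energy dY p (j * m) f)%:E <=
     (6 * 2 `^ p)%:E * (local_modulus dY p sigma n) `^ p * (energy dY p j f)%:E)%E.
Proof.
move=> gap eqm eq1; set Lam := local_modulus _ _ _ _.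
have T0 : 0 < T%:R :> R by rewrite ltr0n.
set A := pair_energy / T%:R ^+ 2; set C := walk_energy 1 / T%:R.
have Em_le : energy dY p (j * m) f <= 2 `^ p * 2 * A.
  have /andP[lo _] := walk_energy_bounds eqm.
  have le2 := le_trans (ler_wpM2l (ltW T0) lo) (walk_energy_le m).
  rewrite /A mulrA ler_pdivlMr ?exprn_gt0 // -mulrA.
  by have -> : forall x y : R, x * y ^+ 2 = y * (y * x) by move=> x y; ring.
have E1_ge : C <= 3 * energy dY p j f.
  have /andP[_] := walk_energy_bounds eq1; rewrite muln1.
  by rewrite /C ler_pdivrMr // -mulrA [energy _ _ _ _ * _]mulrC.
have A0 : 0 <= A by rewrite divr_ge0 ?sqr_ge0 ?sumr_ge0 // => *; rewrite ?sumr_ge0 // => *; exact: powR_ge0.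
have C0 : 0 <= C by rewrite divr_ge0 // sumr_ge0 // => *; exact: powR_ge0.
have key : (A%:E <= Lam `^ p * C%:E)%E.
  (* [Lam] may be infinite, and [+oo * 0 = 0], so [C = 0] needs its own argument: [h] is then
     constant on edges, hence constant by connectedness, and [A = 0]. *)
  have [C0'|CN0] := eqVneq C 0.
    suff -> : A = 0 by rewrite mule_ge0 ?poweR_ge0 // lee_fin.
    have /eqP S0 : walk_energy 1 == 0 by have/eqP := C0'; rewrite mulf_eq0 invr_eq0 (gt_eqF T0) orbF.
    have hadj u v : adj u v -> h u = h v.
      move=> uv; case: dYP => d0 _ _; apply/d0.
      apply: (@powR_eq0_eq0 _ _ p).
      have /psumr_eq0P : walk_energy 1 = 0 by [].
      move=> /(_ (fun _ _ => powR_ge0 _ _)) /(_ (exist _ (u, v) uv : dart adj) isT).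
      by [].
    have hcst u v : h u = h v.
      have /connectP[q] := adj_conn u v.
      by elim: q u => [|x q IH] u /=; [move=> _ -> | case/andP=> /hadj -> /IH].
    rewrite /A /pair_energy big1 ?mul0r // => e _; rewrite big1 // => e' _.
    by case: dYP => d0 _ _; rewrite (d0 _ _).2 ?powR0 ?gt_eqF.
  have CP : 0 < C by rewrite lt_neqAle eq_sym CN0.
  (* The image of [h], listed by [n] entries, competes in the supremum; each constant admissible for
     it is at least [(A / C) ^ (1 / p)]. *)
  have modle : (((A / C) `^ p^-1)%:E <= Lam)%E.
    pose Z := [seq h u | u <- enum 'I_n].
    apply: (@le_trans _ _ (poincare_modulus dY p sigma Z)); last first.
      by apply: ereal_sup_ubound; exists Z => //=; rewrite size_map size_enum_ord.
    apply: le_ereal_inf_tmp => _ [L [L0 Lok] <-]; rewrite lee_fin.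
    have := Lok n _ _ rev_markov_chain_avg_op gap h.
    have hZ u : List.In (h u) Z by apply: List.in_map; apply: mem_In; rewrite mem_enum.
    move/(_ hZ); rewrite pair_energyE step_energyE -/A -/C -ler_pdivrMr // => AC.
    have := ge0_ler_powR (r := p^-1) _ _ _ AC.
    rewrite -powRrM divff ?gt_eqF // powRr1 //; apply.
    + by rewrite invr_ge0 ltW.
    + by rewrite nnegrE divr_ge0.
    + by rewrite nnegrE powR_ge0.
  have : ((A / C)%:E <= Lam `^ p)%E.
    have -> : (A / C) = ((A / C) `^ p^-1) `^ p.
      by rewrite -powRrM mulVf ?gt_eqF // powRr1 // divr_ge0.
    rewrite -poweR_EFin; apply: gt0_ler_poweR => //; first exact: ltW.
    + by rewrite in_itv /= lee_fin powR_ge0 leey.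
    + by rewrite in_itv /= leey andbT (le_trans _ modle) // lee_fin powR_ge0.
  move=> AC; have -> : A%:E = ((A / C)%:E * C%:E)%E by rewrite -EFinM divfK.
  by apply: lee_wpmul2r => //; rewrite lee_fin.
apply: (@le_trans _ _ ((2 `^ p * 2)%:E * (Lam `^ p * (3 * energy dY p j f)%:E))%E).
  apply: (@le_trans _ _ ((2 `^ p * 2)%:E * A%:E)%E); first by rewrite -EFinM lee_fin.
  apply: lee_wpmul2l; first by rewrite lee_fin mulr_ge0 // powR_ge0.
  apply: le_trans key _; apply: lee_wpmul2l; first exact: poweR_ge0.
  by rewrite lee_fin.
have -> : 6 * 2 `^ p = 2 `^ p * 2 * 3 by ring.
by rewrite (EFinM _ 3) (EFinM 3) -!muleA (muleCA (Lam `^ p)%E).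
Qed.

End VertexMap.
End Transfer.

(** * Probability of a bad labeling and choice of the walk length *)

(** The failure bound for length 1 is dominated by the one for length [m], and there are at least
    [n] oriented edges. Since [m <= (2 * k) ^ m], the resulting [32 * m ^ 2 * Q ^ (2 * m)] is at
    most [n]. *)
Lemma card_bad_labeling (R : realType) k j m n (adj : rel 'I_n)
    (adjP : simple_graph adj) :
  (0 < k)%N -> (0 < n)%N -> (0 < m)%N -> (forall u, (1 < deg adj u)%N) ->
  (forall s, simple_cycle adj s -> (m < size s)%N) ->
  (32 * (2 * k) ^ (2 * j.+1 * m) <= n)%N ->
  (2 * #|[set a : labeling_i k j adj |
     ~~ (equidistributed R (turn adjP) (und adjP) (@ori n adj k j) m a &&
         equidistributed R (turn adjP) (und adjP) (@ori n adj k j) 1 a)]| <=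
   #|{: labeling_i k j adj}|)%N.
Proof.
move=> k0 n0 m0 deg1 girth nB.
set Bad := [set _ | _]; set L := #|{: labeling_i k j adj}|.
pose T := #|{: dart adj}|; pose Q := #|{: j.-tuple (letter k)}|.
have QE : Q = ((2 * k) ^ j)%N by rewrite /Q card_tuple card_prod card_ord card_bool mulnC.
have nT : (n <= T)%N.
  rewrite -(ler_nat R) (card_dart R adj) -natr_sum ler_nat.
  rewrite -[X in (X <= _)%N]card_ord -sum1_card; apply: leq_sum => u _.
  exact: ltnW (deg1 u).
have T0 : (0 < T)%N := leq_trans n0 nT.
have girth1 s : simple_cycle adj s -> (1 < size s)%N by case/and3P => /ltnW.
have bad m' : (forall s, simple_cycle adj s -> (m' < size s)%N) ->
  (#|[set a : labeling_i k j adj | ~~ equidistributed R (turn adjP) (und adjP) (@ori n adj k j) m' a]| * T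
   <= 8 * m' ^ 2 * Q ^ (m' + m') * L)%N.
  move=> g'; apply: card_not_equidistributed => //.
  - exact: turn_inj.
  - exact: oriK.
  - exact: und_fiber.
  - by move=> e; exact: und_iter_turn_inj.
have Ble : (#|Bad| * T <= 16 * m ^ 2 * Q ^ (m + m) * L)%N.
  have -> : Bad = [set a | ~~ equidistributed R (turn adjP) (und adjP) (@ori n adj k j) m a] :|:
     [set a | ~~ equidistributed R (turn adjP) (und adjP) (@ori n adj k j) 1 a].
    by apply/setP => a; rewrite !inE negb_and.
  apply: leq_trans (leq_mul (leq_card_setU _ _) (leqnn T)) _.
  rewrite mulnDl; apply: leq_trans (leq_add (bad m girth) (bad 1 girth1)) _.
  have Q2 : (8 * 1 ^ 2 * Q ^ (1 + 1) * L <= 8 * m ^ 2 * Q ^ (m + m) * L)%N.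
    rewrite leq_mul2r; apply/orP; right; apply: leq_mul.
      by rewrite leq_mul2l /= leq_exp2r.
    by rewrite leq_pexp2l ?QE ?expn_gt0 ?muln_gt0 ?k0 //; lia.
  by apply: leq_trans (leq_add (leqnn _) Q2) _; rewrite -mulnDl -!mulnDl.
rewrite -(leq_pmul2r T0) -mulnA.
apply: leq_trans (leq_mul (leqnn 2) Ble) _.
rewrite mulnA [(L * T)%N]mulnC leq_mul2r; apply/orP; right.
apply: leq_trans nT; apply: leq_trans nB.
have -> : (2 * (16 * m ^ 2 * Q ^ (m + m)) = 32 * (m ^ 2 * Q ^ (m + m)))%N by lia.
rewrite leq_pmul2l //.
have mk : (m <= (2 * k) ^ m)%N.
  apply: leq_trans (ltnW (ltn_expl m (isT : 1 < 2)%N)) _.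
  by rewrite leq_exp2r //; lia.
have -> : ((2 * k) ^ (2 * j.+1 * m) = ((2 * k) ^ m) ^ 2 * Q ^ (m + m))%N.
  by rewrite QE -!expnM -expnD; congr expn; lia.
by rewrite leq_mul2r leq_exp2r // mk orbT.
Qed.

(** The last bound uses [m + 1 <= 2 * m], valid because [m >= 1]. *)
Lemma trunc_log_ln (R : realType) (b n : nat) : (1 < b)%N -> (b <= n)%N ->
  [/\ (0 < trunc_log b n)%N,
      (trunc_log b n)%:R * ln b%:R <= ln n%:R :> R &
      ln n%:R <= 2 * (trunc_log b n)%:R * ln b%:R :> R].
Proof.
move=> b1 bn; have n0 : (0 < n)%N := leq_trans (ltnW b1) bn.
have b0 : 0 < b%:R :> R by rewrite ltr0n ltnW.
set m := trunc_log b n.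
have m0 : (0 < m)%N by rewrite trunc_log_gt0 b1 /=; lia.
have lnb0 : 0 <= ln b%:R :> R by rewrite ln_ge0 // ler1n ltnW.
split=> //.
  rewrite mulr_natl -lnXn // ler_ln ?posrE ?exprn_gt0 ?ltr0n ?(ltnW b1) //.
  by rewrite -natrX ler_nat trunc_logP.
apply: (@le_trans _ _ ((m.+1)%:R * ln (b%:R : R))).
  rewrite mulr_natl -lnXn // ler_ln ?posrE ?exprn_gt0 ?ltr0n ?(ltnW b1) //.
  by rewrite -natrX ler_nat ltnW // trunc_log_ltn.
by apply: ler_wpM2r => //; rewrite -natrM ler_nat; lia.
Qed.
Theorem theorem7p5 (R : realType) (k : nat) (N : nat -> nat)
  (adj : forall i, rel 'I_(N i)) (d : nat) (sigma c : R) (j : nat) (p : R) :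
  (0 < k)%N ->
  (forall i, simple_graph (adj i)) ->
  (forall i, connected_graph (adj i)) ->
  (forall i, ~ bipartite (adj i)) ->
  (forall M : nat, exists i0 : nat, forall i, (i0 <= i)%N -> (M <= N i)%N) ->
  (forall i u, (3 <= deg (adj i) u <= d)%N) ->
  0 < sigma ->
  (forall i, spectral_gap_ge (avg_op R (adj i)) sigma) ->
  0 < c ->
  (forall i, girth_ge (adj i) (c * ln (N i)%:R)) ->
  ~~ odd j ->
  2 <= p ->
  @almost_surely R (fun i => labeling_i k j (adj i))
    (fun alpha =>
      exists a b K : R, [/\ 0 < a, 0 < b, 0 < K &
        forall (Y : Type) (dY : Y -> Y -> R), is_metric dY ->
        forall act : FreeGroup k -> Y -> Y,
          isometric_action dY act -> kills_relators alpha act ->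
        forall M : nat, exists i : nat, (M <= N i)%N /\
          forall f : FreeGroup k -> Y, equivariant act f ->
            exists m : nat,
              [/\ a * ln (N i)%:R <= m%:R, m%:R <= b * ln (N i)%:R &
                 ((energy dY p (j * m) f)%:E <=
                    K%:E * (local_modulus dY p sigma (N i)) `^ p
                      * (energy dY p j f)%:E)%E]]).
Proof.
move=> k0 adjP conn _ Ninf degP _ gap c0 girth _ p2.
have p0 : 0 < p by apply: lt_le_trans p2.
have [E0 hE0] : exists E0 : nat, expR c^-1 < E0%:R :> R.
  by eexists; apply: archi_boundP; exact: expR_ge0.
have E0_gt0 : (0 < E0)%N by rewrite -(ltr0n R); exact: lt_trans (expR_gt0 _) hE0.
(* With [m] the integer logarithm of [N i] in base [B], the first two factors give the size
   condition of [card_bad_labeling], since [B ^ m <= N i]. The factor [E0] gives [ln B > 1 / c],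
   hence [m < c * ln (N i)], which is below the girth. *)
pose B := (32 * (2 * k) ^ (2 * j.+1) * E0)%N.
have kk0 : (0 < (2 * k) ^ (2 * j.+1))%N by rewrite expn_gt0 muln_gt0 k0.
have B1 : (1 < B)%N by rewrite /B; nia.
have lnB : c^-1 < ln B%:R.
  rewrite -[X in X < _]expRK ltr_ln ?posrE ?expR_gt0 ?ltr0n ?(ltnW B1) //.
  by apply: lt_le_trans hE0 _; rewrite ler_nat /B; nia.
have lnB0 : 0 < ln B%:R :> R by apply: lt_trans lnB; rewrite invr_gt0.
pose m i := trunc_log B (N i).
have deg1 i u : (1 < deg (adj i) u)%N by have /andP[/ltnW] := degP i u.
have short i : (B <= N i)%N -> forall s, simple_cycle (adj i) s -> (m i < size s)%N.
  move=> Bi s /girth gs; have [m0 mlo _] := trunc_log_ln R B1 Bi.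
  rewrite -(ltr_nat R); apply: lt_le_trans gs; rewrite mulrC -ltr_pdivrMr //.
  by apply: lt_le_trans mlo; rewrite ltr_pM2l // ltr0n.
pose good i (a : labeling_i k j (adj i)) :=
  equidistributed R (turn (adjP i)) (und (adjP i)) (@ori _ (adj i) k j) (m i) a &&
  equidistributed R (turn (adjP i)) (und (adjP i)) (@ori _ (adj i) k j) 1 a.
pose Bad i := [set a : labeling_i k j (adj i) | ~~ good i a].
have [i1 hi1] := Ninf B.
have half i : (i1 <= i)%N -> (2 * #|Bad i| <= #|{: labeling_i k j (adj i)}|)%N.
  move=> /hi1 Bi; have [m0 _ _] := trunc_log_ln R B1 Bi.
  have n0 : (0 < N i)%N := leq_trans (ltnW B1) Bi.
  apply: card_bad_labeling => //; first exact: short.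
  apply: leq_trans (trunc_logP B1 n0); rewrite -/(m i) /B (expnMn _ E0) (expnMn 32) -expnM.
  rewrite -[X in (X <= _)%N]muln1; apply: leq_mul; last by rewrite expn_gt0 E0_gt0.
  by rewrite leq_mul2r -[X in (X <= _)%N]expn1 leq_pexp2l // orbT.
move=> eps eps0; have [M [A [cov sumA]]] := @prod_null_tail R _ Bad i1 half eps eps0.
(* It is enough that the conclusion holds whenever [w i] is good for infinitely many [i]: the
   exceptional set then lies in the null tail event. *)
exists M, A; split=> // w nPw; apply: cov; apply: contrapT => Hn; apply: nPw.
(* The bounds on [m] are those of [trunc_log_ln]; the last constant is that of [energy_transfer].
   None of them depends on [w]. *)
exists (2 * ln B%:R)^-1, (ln B%:R)^-1, (6 * 2 `^ p).
split; rewrite ?invr_gt0 ?mulr_gt0 ?powR_gt0 // => Y dY dYP act actP kill M0.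
have [i2 hi2] := Ninf (maxn M0 B).
have [i [hi good_i]] : exists i, (i2 <= i)%N /\ good i (w i).
  apply: contrapT => Hg; apply: Hn; exists i2 => i hi; rewrite inE.
  by apply/negP => gi; apply: Hg; exists i.
have := hi2 _ hi; rewrite geq_max => /andP[Mi Bi].
exists i; split=> // f fP.
have [m0 mlo mhi] := trunc_log_ln R B1 Bi.
have n0 : (0 < N i)%N := leq_trans (ltnW B1) Bi.
have deg0 u : (0 < deg (adj i) u)%N := ltnW (deg1 i u).
have [h hE] := vertex_map (adjP i) (conn i) actP fP (kill i) (Ordinal n0).
exists (m i); split.
- by rewrite ler_pdivrMl ?mulr_gt0 // mulrAC.
- by rewrite ler_pdivlMl // mulrC.
have /andP[gm g1] := good_i.
apply: (energy_transfer (adjP := adjP i) (conn i) deg0 (a := w i) dYP p0 hE) => //.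
apply/card_gt0P.
have : (0 < deg (adj i) (Ordinal n0))%N by [].
rewrite /deg => /card_gt0P[v]; rewrite inE => uv.
by exists (exist _ (Ordinal n0, v) uv : dart (adj i)).
Qed.
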